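(* Let $R \subset \mathbb{R}$ be a unital subring and let $\mathscr{C}$ be one of the categories $\mathtt{Semi}$, $\mathtt{Mon}$, $R\text{-}\mathtt{Mod}$, $R\text{-}\mathtt{NMod}$, $\overline{R}\text{-}\mathtt{Mod}$, $\overline{R}\text{-}\mathtt{NMod}$. Given a set $X$ and an object $M \in \mathscr{C}$ with metric $d_M$, let $F_b(X,M)$ denote the set of bounded functions $f : X \to M$, and define $$d(f,g) = \sup_{x,x' \in X} d_M\big(f(x)+g(x'),\, f(x')+g(x)\big), \qquad f,g \in F_b(X,M).$$ Then for every nonempty set $X$ that is not a singleton: (1) $d$ is a pseudometric on $F_b(X,M)$ for every object $M$ of $\mathscr{C}$. (2) If one defines $f \sim g$ to mean $d(f,g)=0$, then $\sim$ is an equivalence relation on $F_b(X,M)$, and the quotient space assignment $M \mapsto F_b(X,M)/\sim$ is a covariant isometric endofunctor of the category $\mathscr{C}$.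
   Context: Categories (for a unital subring $R \subset \mathbb{R}$): - $\mathtt{Semi}$: objects are abelian topological semigroups $(\mathscr{G},+,d_{\mathscr{G}})$ whose topology is given by a metric $d_{\mathscr{G}}$ that is translation-invariant: $d_{\mathscr{G}}(x+z,y+z) = d_{\mathscr{G}}(x,y)$ for all $x,y,z \in \mathscr{G}$. Morphisms are the semigroup homomorphisms that are Lipschitz. - $\mathtt{Mon}$: the full subcategory of $\mathtt{Semi}$ whose objects are monoids. - $R\text{-}\mathtt{Mod}$: the subcategory of $\mathtt{Semi}$ whose objects are $R$-modules such that multiplication by each scalar in $R$ is a Lipschitz map, and whose morphisms are Lipschitz $R$-module maps. - $R\text{-}\mathtt{NMod}$: the full subcategory of $R\text{-}\mathtt{Mod}$ whose objects are $R$-normed, i.e. $d_{\mathscr{G}}(0,ra) = |r|\, d_{\mathscr{G}}(0,a)$ for all $r \in R$, $a \in \mathscr{G}$. - $\overline{R}\text{-}\mathtt{Mod}$ and $\overline{R}\text{-}\mathtt{NMod}$: the full subcategories of $R\text{-}\mathtt{Mod}$ and $R\text{-}\mathtt{NMod}$ respectively, whose objects are complete metric spaces. The quotient $F_b(X,M)/\sim$ carries the metric induced by $d$, and addition (and the identity element and scalar multiplication by $R$, when $M$ has these) induced by the pointwise operations on $F_b(X,M)$. On morphisms, the assignment sends $\varphi : M \to N$ to $[\varphi] : F_b(X,M)/\sim \ \to F_b(X,N)/\sim$, $[f] \mapsto [\varphi \circ f]$. A functor $F : \mathscr{C} \to \mathscr{C}'$ is called isometric if (a) all $\mathrm{Hom}$-spaces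 in $\mathscr{C}$ and $\mathscr{C}'$ are metric spaces, and (b) $F : \mathrm{Hom}(C_1,C_2) \to \mathrm{Hom}(F(C_1),F(C_2))$ is an isometry (distance-preserving) for all objects $C_1,C_2 \in \mathscr{C}$. Here the metric on $\mathrm{Hom}(M,N)$, in each of the categories $\mathtt{Semi}$, $\mathtt{Mon}$, $R\text{-}\mathtt{Mod}$, $R\text{-}\mathtt{NMod}$, $\overline{R}\text{-}\mathtt{Mod}$, $\overline{R}\text{-}\mathtt{NMod}$, is $$d(\eta,\varphi) = \sup_{m \neq m' \in M} \frac{d_N\big(\eta(m)+\varphi(m'),\, \varphi(m)+\eta(m')\big)}{d_M(m,m')},$$ with the supremum over an empty set taken to be $0$. *)

(* Defs.v *)
From HB Require Import structures.
From mathcomp Require Import all_boot all_order all_algebra.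
From mathcomp Require Import boolp classical_sets functions reals topology.

Set Implicit Arguments.
Unset Strict Implicit.
Unset Printing Implicit Defensive.

Import Order.TTheory GRing.Theory Num.Theory.

Local Open Scope classical_set_scope.
Local Open Scope ring_scope.

Section Metric.
Context {K : realType}.

Definition is_pseudometric (T : Type) (d : T -> T -> K) : Prop :=
  [/\ forall x y, 0 <= d x y, forall x, d x x = 0,
      forall x y, d x y = d y x & forall x y z, d x z <= d x y + d y z].

Definition is_metric (T : Type) (d : T -> T -> K) : Prop :=
  is_pseudometric d /\ forall x y, d x y = 0 -> x = y.

(* The library's Lipschitz predicates are restricted to normed modules. *)
Definition lipschitz_map (M N : metricType K) (f : M -> N) : Prop :=
  exists k : K, forall x y, mdist (f x) (f y) <= k * mdist x y.

Definition bounded_map (X : Type) (M : metricType K) (f : X -> M) : Prop :=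
  exists k : K, forall x x', mdist (f x) (f x') <= k.

End Metric.

(* The axiom of the library's [completeType], whose instances must in addition
   carry a distinguished point. *)
Definition complete_space (T : uniformType) : Prop :=
  forall F : set_system T, ProperFilter F -> cauchy F -> exists l : T, F --> l.

HB.mixin Record isTranslationInvariant (K : numDomainType) M
    & Metric K M & Algebra.AddSemigroup M := {
  mdistD2r : forall x y z : M, mdist (x + z) (y + z) = mdist x y;
  addr_continuous : continuous (fun xy : M * M => xy.1 + xy.2)
}.

#[short(type="metricSemigroupType")]
HB.structure Definition MetricSemigroup (K : numDomainType) :=
  {M of Metric K M & Algebra.AddSemigroup M & isTranslationInvariant K M}.

Definition scalars (K : realType) (S : subringClosed K) : Type :=
  {x : K | x \in S}.
HB.instance Definition _ (K : realType) (S : subringClosed K) :=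
  SubChoice.on (scalars S).
HB.instance Definition _ (K : realType) (S : subringClosed K) :=
  [SubChoice_isSubComNzRing of scalars S by <:].

HB.mixin Record hasLipschitzScale (K : realType) (S : subringClosed K) M
    & MetricSemigroup K M & GRing.Lmodule (scalars S) M := {
  scale_lipschitz : forall r : scalars S, lipschitz_map (fun x : M => r *: x)
}.

#[short(type="metricLmodType")]
HB.structure Definition MetricLmodule (K : realType) (S : subringClosed K) :=
  {M of MetricSemigroup K M & GRing.Lmodule (scalars S) M
     & hasLipschitzScale K S M}.

Definition is_monoid (K : realType) (M : metricSemigroupType K) : Prop :=
  exists e : M, forall a : M, e + a = a.

Definition is_normed (K : realType) (S : subringClosed K)
    (M : metricLmodType S) : Prop :=
  forall (r : scalars S) (a : M),
    mdist (0 : M) (r *: a) = `|val r| * mdist (0 : M) a.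

Record category := Category {
  obj :> Type;
  Hom : obj -> obj -> Type;
  idm : forall a, Hom a a;
  comp : forall a b c, Hom b c -> Hom a b -> Hom a c;
  comp1m : forall a b (f : Hom a b), comp (idm b) f = f;
  compm1 : forall a b (f : Hom a b), comp f (idm a) = f;
  compA : forall a b c d (f : Hom c d) (g : Hom b c) (h : Hom a b),
    comp f (comp g h) = comp (comp f g) h
}.
Arguments comp {_ _ _ _}.

Definition is_functor (C D : category) (F0 : C -> D)
    (F1 : forall a b, Hom a b -> Hom (F0 a) (F0 b)) : Prop :=
  (forall a, F1 a a (idm a) = idm (F0 a)) /\
  (forall a b c (f : Hom b c) (g : Hom a b),
     F1 a c (comp f g) = comp (F1 b c f) (F1 a b g)).

Definition is_isometric (K : realType) (C D : category)
    (dC : forall a b : C, Hom a b -> Hom a b -> K)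
    (dD : forall a b : D, Hom a b -> Hom a b -> K)
    (F0 : C -> D) (F1 : forall a b, Hom a b -> Hom (F0 a) (F0 b)) : Prop :=
  [/\ forall a b, is_metric (dC a b), forall a b, is_metric (dD a b)
    & forall a b (f g : Hom a b),
        dD (F0 a) (F0 b) (F1 a b f) (F1 a b g) = dC a b f g].

(* A category of metric semigroups is presented by the structure that its
   objects carry: an object is a type [T] with an element of [structure T]. Its
   morphisms are the Lipschitz semigroup homomorphisms that commute with the
   operators [act]; the operators are the scalar multiplications for modules,
   and there are none for [Semi]. *)
Record semi_category (K : realType) := SemiCategory {
  structure : Type -> Type;
  semi_class : forall T, structure T -> MetricSemigroup.axioms_ K T;
  operator : Type;
  act : forall T, structure T -> operator -> T -> T;
  act_lipschitz : forall T (s : structure T) (r : operator),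
    let M : metricSemigroupType K := MetricSemigroup.Pack (semi_class s) in
    lipschitz_map (act s r : M -> M)
}.
Arguments act {_ _ _}.

Definition full_sub (K : realType) (C : semi_category K)
    (P : forall T, structure C T -> Prop) : semi_category K :=
  @SemiCategory K (fun T => {s : structure C T | P T s})
    (fun T s => semi_class (sval s)) (operator C)
    (fun T s => act (sval s)) (fun T s => act_lipschitz (sval s)).

Definition Semi (K : realType) : semi_category K :=
  @SemiCategory K (MetricSemigroup.axioms_ K) (fun T s => s) void
    (fun T s r => of_void _ r) (fun T s r => match r with end).

Definition Mon (K : realType) : semi_category K :=
  @full_sub K (Semi K) (fun T s => is_monoid (MetricSemigroup.Pack s)).

Section ModuleCategories.
Context {K : realType} (S : subringClosed K).

Definition RMod : semi_category K :=
  @SemiCategory K (MetricLmodule.axioms_ S)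
    (fun T s => MetricSemigroup.class (MetricLmodule.Pack s : metricLmodType S))
    (scalars S)
    (fun T s r (x : (MetricLmodule.Pack s : metricLmodType S)) => r *: x)
    (fun T s => @scale_lipschitz K S (MetricLmodule.Pack s)).

Definition RNMod : semi_category K :=
  @full_sub K RMod (fun T s => is_normed (MetricLmodule.Pack s)).

Definition RMod_complete : semi_category K :=
  @full_sub K RMod
    (fun T s => complete_space (MetricLmodule.Pack s : metricLmodType S)).

Definition RNMod_complete : semi_category K :=
  @full_sub K RNMod
    (fun T s => complete_space (MetricLmodule.Pack (sval s) : metricLmodType S)).

End ModuleCategories.

Record object (K : realType) (C : semi_category K) := Object {
  carrier : Type;
  object_structure : structure C carrier
}.

Definition semigroup_of (K : realType) (C : semi_category K) (M : object C) :
    metricSemigroupType K :=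
  MetricSemigroup.Pack (semi_class (object_structure M)).
Coercion semigroup_of : object >-> MetricSemigroup.type.

Section Morphisms.
Context {K : realType} {C : semi_category K}.

Definition is_morphism (M N : object C) (phi : M -> N) : Prop :=
  [/\ {morph phi : x y / x + y}, lipschitz_map phi
    & forall (r : operator C) (x : M),
        phi (act (object_structure M) r x) = act (object_structure N) r (phi x)].

Record morphism (M N : object C) := Morphism {
  mor_fun :> M -> N;
  morP : is_morphism mor_fun
}.

Lemma morphism_ext (M N : object C) (phi psi : morphism M N) :
  mor_fun phi = mor_fun psi -> phi = psi.
Proof.
case: phi psi => [f Pf] [g Pg] /= fg; case: _ / fg Pg => Pg.
by rewrite (Prop_irrelevance Pf Pg).
Qed.

Lemma is_morphism_id (M : object C) : is_morphism (fun x : M => x).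
Proof. by split=> //; exists 1 => x y; rewrite mul1r. Qed.

Lemma is_morphism_comp (M N P : object C) (psi : morphism N P)
    (phi : morphism M N) : is_morphism (fun x => psi (phi x)).
Proof.
case: psi phi => [g [gD [k gk] gact]] [f [fD [l fl] fact]]; split=> /=.
- by move=> x y; rewrite fD gD.
- exists (`|k| * l) => x y; apply: le_trans (gk _ _) _.
  apply: (@le_trans _ _ (`|k| * mdist (f x) (f y))).
    by rewrite ler_wpM2r ?mdist_ge0 ?ler_norm.
  by rewrite -mulrA ler_wpM2l.
- by move=> r x; rewrite fact gact.
Qed.

Definition id_morphism (M : object C) : morphism M M :=
  Morphism (is_morphism_id M).

Definition comp_morphism (M N P : object C) (psi : morphism N P)
    (phi : morphism M N) : morphism M P :=
  Morphism (is_morphism_comp psi phi).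

Lemma comp_morphism1m (M N : object C) (phi : morphism M N) :
  comp_morphism (id_morphism N) phi = phi.
Proof. exact: morphism_ext. Qed.

Lemma comp_morphismm1 (M N : object C) (phi : morphism M N) :
  comp_morphism phi (id_morphism M) = phi.
Proof. exact: morphism_ext. Qed.

Lemma comp_morphismA (M N P Q : object C) (chi : morphism P Q)
    (psi : morphism N P) (phi : morphism M N) :
  comp_morphism chi (comp_morphism psi phi) =
  comp_morphism (comp_morphism chi psi) phi.
Proof. exact: morphism_ext. Qed.

Definition hom_ratios (M N : object C) (eta phi : morphism M N) : set K :=
  [set r | exists m m' : M, m <> m' /\
     r = mdist (eta m + phi m') (phi m + eta m') / mdist m m'].

(* The supremum of the empty set is 0 by [sup0]. *)
Definition hom_dist (M N : object C) (eta phi : morphism M N) : K :=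
  sup (hom_ratios eta phi).

End Morphisms.

Definition category_of (K : realType) (C : semi_category K) : category :=
  Category (@comp_morphism1m K C) (@comp_morphismm1 K C) (@comp_morphismA K C).

Record Fb (K : realType) (X : Type) (M : metricType K) := BoundedFun {
  bfun :> X -> M;
  bfunP : bounded_map bfun
}.

Section BoundedFunctions.
Context {K : realType} {X : Type}.

Lemma bounded_cst (M : metricType K) (a : M) : bounded_map (fun _ : X => a).
Proof. by exists 0 => x x'; rewrite mdistxx. Qed.

Lemma bounded_comp (M N : metricType K) (phi : M -> N) (f : Fb X M) :
  lipschitz_map phi -> bounded_map (fun x => phi (f x)).
Proof.
case: f => f [l fl] [k phik] /=; exists (`|k| * l) => x x'.
apply: le_trans (phik _ _) _.
apply: (@le_trans _ _ (`|k| * mdist (f x) (f x'))).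
  by rewrite ler_wpM2r ?mdist_ge0 ?ler_norm.
by rewrite ler_wpM2l.
Qed.

Lemma bounded_add (M : metricSemigroupType K) (f g : Fb X M) :
  bounded_map (fun x => f x + g x).
Proof.
case: f g => f [k fk] [g [l gl]] /=; exists (k + l) => x x'.
apply: le_trans (metric_triangle _ (f x' + g x) _) _.
by rewrite mdistD2r ![f x' + _]Algebra.addrC mdistD2r lerD.
Qed.

Definition Fb_cst (M : metricType K) (a : M) : Fb X M :=
  BoundedFun (bounded_cst a).

Definition Fb_comp (M N : metricType K) (phi : M -> N)
    (phi_lip : lipschitz_map phi) (f : Fb X M) : Fb X N :=
  BoundedFun (bounded_comp f phi_lip).

Definition Fb_add (M : metricSemigroupType K) (f g : Fb X M) : Fb X M :=
  BoundedFun (bounded_add f g).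

Section Distance.
Context {M : metricSemigroupType K}.

Definition Fb_gaps (f g : Fb X M) : set K :=
  [set r | exists x x' : X, r = mdist (f x + g x') (f x' + g x)].

Definition Fb_dist (f g : Fb X M) : K := sup (Fb_gaps f g).

Definition Fb_sim (f g : Fb X M) : Prop := Fb_dist f g = 0.

End Distance.

Definition is_Fb_class (M : metricSemigroupType K) (A : set (Fb X M)) : Prop :=
  exists f : Fb X M, A = Fb_sim f.

End BoundedFunctions.
Arguments Fb_dist {K} X M.
Arguments Fb_sim {K} X M.

(* The set of classes [Fb_sim f]; that [Fb_sim] is an equivalence relation is
   not needed to form it. *)
Definition Fb_quot (K : realType) (X : Type) (M : metricSemigroupType K) : Type :=
  {A : set (Fb X M) | is_Fb_class A}.

Definition Fb_class (K : realType) (X : Type) (M : metricSemigroupType K)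
    (f : Fb X M) : Fb_quot X M :=
  exist _ (Fb_sim X M f) (ex_intro _ f erefl).

Section Functor.
Context {K : realType} {C : semi_category K} {X : Type}.

Definition Fb_act (M : object C) (r : operator C) (f : Fb X M) : Fb X M :=
  Fb_comp (act_lipschitz (object_structure M) r) f.

Definition Fb_map (M N : object C) (phi : morphism M N) (f : Fb X M) : Fb X N :=
  Fb_comp (let: And3 _ phi_lip _ := morP phi in phi_lip) f.

(* [q] is the structure induced on the quotient; the third clause says that an
   identity element of [M] induces one. *)
Definition is_induced (M : object C) (q : structure C (Fb_quot X M)) : Prop :=
  let Q := Object q in
  let pi (f : Fb X M) : Q := Fb_class f in
  [/\ forall f g, mdist (pi f) (pi g) = Fb_dist X M f g,
      forall f g, pi f + pi g = pi (Fb_add f g),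
      forall e : M, (forall a : M, e + a = a) ->
        forall A : Q, pi (Fb_cst e) + A = A
    & forall (r : operator C) (f : Fb X M), act q r (pi f) = pi (Fb_act r f)].

End Functor.

(* Main.v *)
From HB Require Import structures.
Require Import Defs.
From mathcomp Require Import all_boot all_order all_algebra.
From mathcomp Require Import boolp classical_sets reals topology.
From mathcomp Require Import lra.
From Stdlib Require Import RelationClasses.

Set Implicit Arguments.
Unset Strict Implicit.
Unset Printing Implicit Defensive.

Import Order.TTheory GRing.Theory Num.Theory.

Local Open Scope classical_set_scope.
Local Open Scope ring_scope.

(** The natural receiver of all these distances is the group of formal
differences of [M]. In a translation-invariant semigroup cancellation holds and
the distance between [a - a'] and [b - b'] may be computed without subtraction
as [diff_dist a a' b b' = mdist (a + b') (a' + b)]. With this reading: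

- [Fb_dist f g] is the supremum over [x], [x'] of the distance between
  [f x - f x'] and [g x - g x'], so it sees [f] only up to an additive constant.
  It is a pseudometric because [diff_dist] satisfies the triangle inequality
  ([diff_dist_triangle]), and it is compatible with sums and invariant under
  translations because [diff_dist] is.

- [hom_dist eta phi] is the best Lipschitz constant of the formal difference
  [eta - phi]. A morphism is recovered from it since [eta (m + m)] is
  [eta m + eta m]: comparing [eta] and [phi] at [m] and [m + m] and cancelling
  gives [eta m = phi m] ([hom_dist_eq0]).

- The functor is isometric ([quot_morphism_isometric]). One has
  [(eta f + phi g)(x) - (eta f + phi g)(x')], compared with
  [(phi f + eta g)(x) - (phi f + eta g)(x')], at the distance between the values
  of [eta - phi] at [f x + g x'] and at [f x' + g x] ([diff_dist_shuffle]); these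
  two points of [M] are within [Fb_dist f g], so the constant of [eta - phi]
  does not increase. Conversely [X] has two points [x0 <> x1]; for [m], [m'] in
  [M] the function [f] equal to [m] at [x0] and to [m'] elsewhere and the
  constant function [m'] are at distance at most [mdist m m'], and evaluating at
  [x0], [x1] returns the distance between the values of [eta - phi] at [m] and
  [m'].

Well-definedness on classes, functoriality and the isometry use of the category
only that the quotient carries the induced operations, so they are proved once for any
[semi_category]. What depends on the category is that the quotient is again an
object ([induced_quotient_exists]). Semigroup and module laws are inherited
pointwise, and so is the norm identity, since a supremum commutes with the
nonnegative factor [`|r|]. For completeness ([Fb_quot_complete]), a class in a
module has a representative vanishing at a base point [x0], and evaluating these
representatives is 1-Lipschitz; hence a Cauchy filter of classes converges
pointwise, uniformly in [x], and the pointwise limit is bounded. *)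

(** * Suprema of nonnegative reals *)

(** The convention that [sup] is [0] on a set without a supremum agrees with
nonnegativity, and with every nonnegative upper bound when the set is empty. *)
Section SupNonneg.
Context {K : realType}.
Implicit Types (A : set K) (b : K).

Lemma sup_nonneg A : (forall r, A r -> 0 <= r) -> 0 <= sup A.
Proof.
move=> A0; have [[[r Ar] Aub]|/sup_out->//] := pselect (has_sup A).
exact: le_trans (A0 r Ar) (ub_le_sup Aub Ar).
Qed.

Lemma sup_le_nonneg A b : 0 <= b -> ubound A b -> sup A <= b.
Proof.
move=> b0 Ab; have [->|/set0P A0] := eqVneq A set0; first by rewrite sup0.
exact: ge_sup.
Qed.

End SupNonneg.

(** * Distances between formal differences *)

Section TranslationInvariant.
Context {K : realType} {M : metricSemigroupType K}.
Implicit Types a b c x y z t : M.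

Lemma mdistD2l x y z : mdist (z + x) (z + y) = mdist x y :> K.
Proof. by rewrite ![z + _]Algebra.addrC mdistD2r. Qed.

Lemma mdistD_le x y z t : mdist (x + y) (z + t) <= mdist x z + mdist y t :> K.
Proof.
by apply: le_trans (metric_triangle _ (z + y) _) _; rewrite mdistD2r mdistD2l.
Qed.

(** Translations are isometries, hence injective. *)
Lemma addrI_metric x : injective (+%R x).
Proof.
move=> y z /(congr1 (mdist (x + y))).
by rewrite mdistxx mdistD2l => /esym/mdist_positivity.
Qed.

(** The distance between [a - a'] and [b - b'] in the group of formal
differences. *)
Definition diff_dist a a' b b' : K := mdist (a + b') (a' + b).

Lemma diff_distxx a a' : diff_dist a a' a a' = 0.
Proof. by rewrite /diff_dist Algebra.addrC mdistxx. Qed.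

Lemma diff_dist_sym a a' b b' : diff_dist a a' b b' = diff_dist b b' a a'.
Proof.
by rewrite /diff_dist metric_sym Algebra.addrC [_ + b']Algebra.addrC.
Qed.

(** Comparing [a - a'] with [b - b'] is comparing [a - b] with [a' - b']: this
turns the functions' point of view into the morphisms' and back. *)
Lemma diff_dist_swap a a' b b' : diff_dist a a' b b' = diff_dist a b a' b'.
Proof. by rewrite /diff_dist [a' + b]Algebra.addrC. Qed.

Lemma diff_distD2r a a' b b' c c' :
  diff_dist (a + c) (a' + c') (b + c) (b' + c') = diff_dist a a' b b'.
Proof.
rewrite /diff_dist Algebra.addrACA [(a' + _) + _]Algebra.addrACA.
by rewrite [c' + c]Algebra.addrC mdistD2r.
Qed.

Lemma diff_distD_le a a' b b' c c' d d' :
  diff_dist (a + c) (a' + c') (b + d) (b' + d') <=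
  diff_dist a a' b b' + diff_dist c c' d d'.
Proof.
rewrite /diff_dist Algebra.addrACA [(a' + _) + _]Algebra.addrACA.
exact: mdistD_le.
Qed.

(** Adding [b - b'] to both sides of the comparison of [a - a'] and [c - c']
makes the two intermediate differences appear. *)
Lemma diff_dist_triangle a a' b b' c c' :
  diff_dist a a' c c' <= diff_dist a a' b b' + diff_dist b b' c c'.
Proof.
rewrite -(diff_distD2r a a' c c' b b').
rewrite ![_ + b]Algebra.addrC ![_ + b']Algebra.addrC.
rewrite [b + a]Algebra.addrC [b' + a']Algebra.addrC.
exact: diff_distD_le.
Qed.

(** Both sides are the distance between the same two sums of four terms. It
is what turns the comparison of [eta f + phi g] and [phi f + eta g] into a
comparison of [eta - phi] at two points of the source. *)
Lemma diff_dist_shuffle a a' b b' c c' d d' :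
  diff_dist (a + b) (a' + b') (c + d) (c' + d') =
  diff_dist (a + d') (c + b') (a' + d) (c' + b).
Proof.
congr (mdist _ _).
  by rewrite [c' + d']Algebra.addrC [c' + b]Algebra.addrC Algebra.addrACA.
rewrite [LHS]Algebra.addrC [a' + b']Algebra.addrC Algebra.addrACA.
by rewrite [d + a']Algebra.addrC.
Qed.

Lemma diff_dist_le a a' b b' : diff_dist a a' b b' <= mdist a a' + mdist b b'.
Proof. by rewrite /diff_dist [mdist b _]metric_sym mdistD_le. Qed.

End TranslationInvariant.

(** * The pseudometric on bounded functions *)

Section BoundedFunctionDistance.
Context {K : realType} {X : Type} {M : metricSemigroupType K}.
Implicit Types f g h : Fb X M.

Lemma Fb_gaps_bounded f g : has_ubound (Fb_gaps f g).
Proof.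
have [[k fk] [l gl]] := (bfunP f, bfunP g).
exists (k + l) => _ [x [x' ->]]; apply: le_trans (diff_dist_le _ _ _ _) _.
exact: lerD.
Qed.

Lemma Fb_gap_le f g x x' :
  diff_dist (f x) (f x') (g x) (g x') <= Fb_dist X M f g.
Proof. by apply: (ub_le_sup (Fb_gaps_bounded f g)); exists x, x'. Qed.

Lemma Fb_dist_le f g (b : K) : 0 <= b ->
  (forall x x', diff_dist (f x) (f x') (g x) (g x') <= b) ->
  Fb_dist X M f g <= b.
Proof.
by move=> b0 fgb; apply: sup_le_nonneg => // _ [x [x' ->]]; exact: fgb.
Qed.

Lemma Fb_dist_ge0 f g : 0 <= Fb_dist X M f g.
Proof. by apply: sup_nonneg => _ [x [x' ->]]; exact: mdist_ge0. Qed.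

Lemma eq_Fb_dist f g f' g' :
    (forall x x', diff_dist (f x) (f x') (g x) (g x') =
                  diff_dist (f' x) (f' x') (g' x) (g' x')) ->
  Fb_dist X M f g = Fb_dist X M f' g'.
Proof.
move=> E; congr (sup _).
by apply/seteqP; split=> r [x [x' ->]]; exists x, x'; [exact: E | exact/esym/E].
Qed.

Lemma Fb_distxx f : Fb_dist X M f f = 0.
Proof.
apply/eqP; rewrite eq_le Fb_dist_ge0 andbT.
by apply: Fb_dist_le => // x x'; rewrite diff_distxx.
Qed.

Lemma Fb_dist_sym f g : Fb_dist X M f g = Fb_dist X M g f.
Proof.
congr (sup _).
by apply/seteqP; split=> r [x [x' ->]]; exists x, x'; exact: diff_dist_sym.
Qed.

Lemma Fb_dist_triangle f g h :
  Fb_dist X M f h <= Fb_dist X M f g + Fb_dist X M g h.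
Proof.
apply: Fb_dist_le => [|x x']; first by rewrite addr_ge0 ?Fb_dist_ge0.
apply: le_trans (diff_dist_triangle _ _ (g x) (g x') _ _) _.
by rewrite lerD ?Fb_gap_le.
Qed.

Lemma Fb_dist_pseudometric : is_pseudometric (Fb_dist X M).
Proof.
split; [exact: Fb_dist_ge0 | exact: Fb_distxx | exact: Fb_dist_sym |].
by move=> f g h; exact: Fb_dist_triangle.
Qed.

Lemma Fb_distD_le f g f' g' :
  Fb_dist X M (Fb_add f f') (Fb_add g g') <=
  Fb_dist X M f g + Fb_dist X M f' g'.
Proof.
apply: Fb_dist_le => [|x x']; first by rewrite addr_ge0 ?Fb_dist_ge0.
by apply: le_trans (diff_distD_le _ _ _ _ _ _ _ _) _; rewrite lerD ?Fb_gap_le.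
Qed.

Lemma Fb_distD2r f g h :
  Fb_dist X M (Fb_add f h) (Fb_add g h) = Fb_dist X M f g.
Proof. by apply: eq_Fb_dist => x x'; exact: diff_distD2r. Qed.

Lemma Fb_sim_equivalence : Equivalence (Fb_sim X M).
Proof.
split=> [f|f g fg|f g h fg gh].
- exact: Fb_distxx.
- by rewrite /Fb_sim Fb_dist_sym.
- apply/eqP; rewrite /Fb_sim eq_le Fb_dist_ge0 andbT.
  by apply: le_trans (Fb_dist_triangle _ g _) _; rewrite fg gh addr0.
Qed.

Lemma Fb_class_eqP f g : Fb_class f = Fb_class g <-> Fb_sim X M f g.
Proof.
have [simxx simC simT] := Fb_sim_equivalence; split=> [|fg].
  by case=> /(congr1 (@^~ g)) /= ->.
have E : Fb_sim X M f = Fb_sim X M g.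
  apply/funext => h; apply/propext.
  by split; apply: simT => //; exact: simC.
exact: eq_exist.
Qed.

End BoundedFunctionDistance.

(** * The quotient as a translation-invariant metric semigroup *)

Section Quotient.
Context {K : realType} {X : Type} {M : metricSemigroupType K}.
Implicit Types (f g : Fb X M) (A B : Fb_quot X M).

Definition Fb_repr A : Fb X M := sval (cid (svalP A)).

Lemma Fb_reprK : cancel Fb_repr (@Fb_class K X M).
Proof.
case=> A PA; rewrite /Fb_repr; case: cid => f /= E.
by apply: eq_exist; rewrite E.
Qed.

Lemma Fb_class_surj A : exists f, A = Fb_class f.
Proof. by exists (Fb_repr A); rewrite Fb_reprK. Qed.

Lemma Fb_class_repr f : Fb_sim X M (Fb_repr (Fb_class f)) f.
Proof. by apply/Fb_class_eqP; rewrite Fb_reprK. Qed.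

Lemma Fb_dist_sim f g f' g' : Fb_sim X M f f' -> Fb_sim X M g g' ->
  Fb_dist X M f g = Fb_dist X M f' g'.
Proof.
suff le h h' k k' : Fb_sim X M h h' -> Fb_sim X M k k' ->
    Fb_dist X M h k <= Fb_dist X M h' k'.
  have [_ simC _] := @Fb_sim_equivalence K X M.
  by move=> ff' gg'; apply/eqP; rewrite eq_le !le //; exact: simC.
move=> hh' kk'; apply: le_trans (Fb_dist_triangle _ h' _) _.
rewrite hh' add0r; apply: le_trans (Fb_dist_triangle _ k' _) _.
by rewrite [Fb_dist _ _ k' k]Fb_dist_sym kk' addr0.
Qed.

Definition quot_dist A B := Fb_dist X M (Fb_repr A) (Fb_repr B).

Lemma quot_distE f g : quot_dist (Fb_class f) (Fb_class g) = Fb_dist X M f g.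
Proof. by apply: Fb_dist_sim; exact: Fb_class_repr. Qed.

Lemma quot_distxx A : quot_dist A A = 0.
Proof. exact: Fb_distxx. Qed.

Lemma quot_dist_eq0 A B : quot_dist A B = 0 -> A = B.
Proof. by move=> /Fb_class_eqP; rewrite !Fb_reprK. Qed.

Lemma quot_dist_sym A B : quot_dist A B = quot_dist B A.
Proof. exact: Fb_dist_sym. Qed.

Lemma quot_dist_triangle B A D : quot_dist A D <= quot_dist A B + quot_dist B D.
Proof. exact: Fb_dist_triangle. Qed.

HB.instance Definition _ := gen_eqMixin (Fb_quot X M).
HB.instance Definition _ := gen_choiceMixin (Fb_quot X M).
HB.instance Definition _ := @isMetric.Build K (Fb_quot X M) quot_dist
  quot_distxx quot_dist_eq0 quot_dist_sym quot_dist_triangle.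

Lemma mdist_class f g : mdist (Fb_class f) (Fb_class g) = Fb_dist X M f g.
Proof. exact: quot_distE. Qed.

Definition quot_add A B : Fb_quot X M :=
  Fb_class (Fb_add (Fb_repr A) (Fb_repr B)).

Lemma quot_addE f g :
  quot_add (Fb_class f) (Fb_class g) = Fb_class (Fb_add f g).
Proof.
apply/Fb_class_eqP/eqP; rewrite eq_le Fb_dist_ge0 andbT.
by apply: le_trans (Fb_distD_le _ _ _ _) _; rewrite !Fb_class_repr addr0.
Qed.

Lemma eq_Fb_class f g : f =1 g -> Fb_class f = Fb_class g.
Proof.
move=> fg; apply/Fb_class_eqP; rewrite /Fb_sim -[RHS](Fb_distxx f).
by apply: eq_Fb_dist => x x'; rewrite !fg.
Qed.

Lemma quot_addC : commutative quot_add.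
Proof.
move=> A B; have [f ->] := Fb_class_surj A; have [g ->] := Fb_class_surj B.
rewrite !quot_addE.
by apply: eq_Fb_class => x /=; exact: Algebra.addrC.
Qed.

Lemma quot_addA : associative quot_add.
Proof.
move=> A B D; have [f ->] := Fb_class_surj A.
have [g ->] := Fb_class_surj B; have [h ->] := Fb_class_surj D.
by rewrite !quot_addE; apply: eq_Fb_class => x /=; exact: Algebra.addrA.
Qed.

HB.instance Definition _ :=
  Algebra.isAddSemigroup.Build (Fb_quot X M) quot_addC quot_addA.

Lemma addr_class f g : Fb_class f + Fb_class g = Fb_class (Fb_add f g).
Proof. exact: quot_addE. Qed.

Lemma quot_mdistD2r A B D : mdist (A + D) (B + D) = mdist A B.
Proof.
have [f ->] := Fb_class_surj A; have [g ->] := Fb_class_surj B.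
have [h ->] := Fb_class_surj D.
by rewrite !addr_class !mdist_class Fb_distD2r.
Qed.

Lemma quot_add_continuous :
  continuous (fun AB : Fb_quot X M * Fb_quot X M => AB.1 + AB.2).
Proof.
move=> [A B].
apply/(@metricType_numDomainType.cvgrPdist_lt K (Fb_quot X M)) => e e0.
exists (ball A (e / 2), ball B (e / 2)).
  by split; apply: nbhsx_ballx; rewrite divr_gt0.
move=> [A' B'] /= []; rewrite !ballEmdist /= => AA' BB'.
apply: le_lt_trans (metric_triangle _ (A' + B) _) _.
rewrite quot_mdistD2r ![A' + _]Algebra.addrC quot_mdistD2r.
by rewrite [ltRHS](splitr e) ltrD.
Qed.

HB.instance Definition _ :=
  @isTranslationInvariant.Build K (Fb_quot X M)
    quot_mdistD2r quot_add_continuous.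

End Quotient.

(** * The quotient of a metric module *)

Lemma Fb_dist_lipschitz (K : realType) (X : Type) (M N : metricSemigroupType K)
    (phi : M -> N) (phi_lip : lipschitz_map phi) :
    {morph phi : x y / x + y} ->
  exists2 k, 0 <= k & forall f g : Fb X M,
    Fb_dist X N (Fb_comp phi_lip f) (Fb_comp phi_lip g) <= k * Fb_dist X M f g.
Proof.
move=> phiD; have [k phik] := phi_lip; exists `|k| => // f g.
apply: Fb_dist_le => [|x x']; first by rewrite mulr_ge0 ?Fb_dist_ge0.
rewrite /diff_dist /= -!phiD; apply: le_trans (phik _ _) _.
apply: le_trans (ler_wpM2r (mdist_ge0 _ _) (ler_norm k)) _.
by rewrite ler_wpM2l ?normr_ge0 //; exact: Fb_gap_le.
Qed.

Section QuotientModule.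
Context {K : realType} {S : subringClosed K} {X : Type} {M : metricLmodType S}.
Implicit Types (f g : Fb X M) (A B : Fb_quot X M) (r s : scalars S).

Definition Fb_scale r f : Fb X M := Fb_comp (scale_lipschitz r) f.

Lemma Fb_scale_lipschitz r : exists2 k, 0 <= k & forall f g,
  Fb_dist X M (Fb_scale r f) (Fb_scale r g) <= k * Fb_dist X M f g.
Proof. by apply: Fb_dist_lipschitz => x y; exact: scalerDr. Qed.

Definition quot_scale r A : Fb_quot X M := Fb_class (Fb_scale r (Fb_repr A)).

Lemma quot_scaleE r f : quot_scale r (Fb_class f) = Fb_class (Fb_scale r f).
Proof.
apply/Fb_class_eqP/eqP; rewrite eq_le Fb_dist_ge0 andbT.
have [k _ kP] := Fb_scale_lipschitz r; apply: le_trans (kP _ _) _.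
by rewrite Fb_class_repr mulr0.
Qed.

Definition quot_zero : Fb_quot X M := Fb_class (Fb_cst (0 : M)).

(** Negation is a scalar multiplication, so it is already known to preserve
boundedness and classes. *)
Definition quot_opp A := quot_scale (-1) A.

Lemma quot_add0r : left_id quot_zero (@Algebra.add (Fb_quot X M)).
Proof.
move=> A; have [f ->] := Fb_class_surj A; rewrite addr_class.
by apply: eq_Fb_class => x /=; exact: add0r.
Qed.

HB.instance Definition _ := Algebra.hasZero.Build (Fb_quot X M) quot_zero.
HB.instance Definition _ :=
  Algebra.BaseAddUMagma_isAddUMagma.Build (Fb_quot X M) quot_add0r.

Lemma quot_addNr : left_inverse 0 quot_opp (@Algebra.add (Fb_quot X M)).
Proof.
move=> A; have [f ->] := Fb_class_surj A.
rewrite /quot_opp quot_scaleE addr_class.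
by apply: eq_Fb_class => x /=; rewrite scaleN1r; exact: addNr.
Qed.

HB.instance Definition _ :=
  Algebra.Nmodule_isZmodule.Build (Fb_quot X M) quot_addNr.

Lemma quot_scalerA r s A :
  quot_scale r (quot_scale s A) = quot_scale (r * s) A.
Proof.
have [f ->] := Fb_class_surj A; rewrite !quot_scaleE.
by apply: eq_Fb_class => x /=; exact: scalerA.
Qed.

Lemma quot_scale1r : left_id 1 quot_scale.
Proof.
move=> A; have [f ->] := Fb_class_surj A; rewrite quot_scaleE.
by apply: eq_Fb_class => x /=; exact: scale1r.
Qed.

Lemma quot_scalerDr : right_distributive quot_scale +%R.
Proof.
move=> r A B; have [f ->] := Fb_class_surj A; have [g ->] := Fb_class_surj B.
rewrite [X in quot_scale _ X]addr_class !quot_scaleE [RHS]addr_class.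
by apply: eq_Fb_class => x /=; exact: scalerDr.
Qed.

Lemma quot_scalerDl A : {morph quot_scale^~ A : r s / r + s}.
Proof.
have [f ->] := Fb_class_surj A; move=> r s.
rewrite !quot_scaleE [RHS]addr_class.
by apply: eq_Fb_class => x /=; exact: scalerDl.
Qed.

HB.instance Definition _ := GRing.Zmodule_isLmodule.Build (scalars S)
  (Fb_quot X M) quot_scalerA quot_scale1r quot_scalerDr quot_scalerDl.

Lemma scaler_class r f : r *: Fb_class f = Fb_class (Fb_scale r f).
Proof. exact: quot_scaleE. Qed.

Lemma quot_scale_lipschitz r :
  lipschitz_map (fun A : Fb_quot X M => r *: A).
Proof.
have [k _ kP] := Fb_scale_lipschitz r; exists k.
move=> A B; have [f ->] := Fb_class_surj A; have [g ->] := Fb_class_surj B.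
by rewrite !scaler_class !mdist_class.
Qed.

HB.instance Definition _ :=
  @hasLipschitzScale.Build K S (Fb_quot X M) quot_scale_lipschitz.

Lemma mdistB (x x' y y' : M) : mdist (x - x') (y - y') = diff_dist x x' y y'.
Proof.
rewrite /diff_dist -(mdistD2r _ _ (x' + y')) addrA subrK.
by rewrite [x' + y']addrC addrA subrK [y + _]addrC.
Qed.

Lemma normed_mdistZ : is_normed M ->
  forall r (x y : M), mdist (r *: x) (r *: y) = `|val r| * mdist x y.
Proof.
move=> nM r x y.
rewrite -(mdistD2r _ _ (- (r *: x))) -(mdistD2r x _ (- x)).
by rewrite [in LHS]addrN [in RHS]addrN -scalerBr nM.
Qed.

Lemma Fb_distZ : is_normed M -> forall r f g,
  Fb_dist X M (Fb_scale r f) (Fb_scale r g) = `|val r| * Fb_dist X M f g.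
Proof.
move=> nM r f g.
have gapZ x x' : diff_dist (r *: f x) (r *: f x') (r *: g x) (r *: g x') =
    `|val r| * diff_dist (f x) (f x') (g x) (g x').
  by rewrite /diff_dist -normed_mdistZ // !scalerDr.
apply/eqP; rewrite eq_le; apply/andP; split.
  apply: Fb_dist_le => [|x x']; first by rewrite mulr_ge0 ?Fb_dist_ge0.
  by rewrite [leLHS]gapZ ler_wpM2l //; exact: Fb_gap_le.
(* For the reverse inequality the factor has to be moved across [Fb_dist]. *)
have [->|r0] := eqVneq `|val r| 0; first by rewrite mul0r Fb_dist_ge0.
have r_gt0 : 0 < `|val r| by rewrite lt_def r0 normr_ge0.
rewrite -ler_pdivlMl //; apply: Fb_dist_le => [|x x'].
  by rewrite mulr_ge0 ?invr_ge0 ?Fb_dist_ge0.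
rewrite ler_pdivlMl // -gapZ.
exact: (Fb_gap_le (Fb_scale r f) (Fb_scale r g)).
Qed.

Lemma Fb_quot_normed :
  is_normed M -> is_normed (Fb_quot X M : metricLmodType S).
Proof.
move=> nM r A; have [f ->] := Fb_class_surj A.
rewrite -[X in mdist X _ = _](scaler0 _ r) !scaler_class !mdist_class.
exact: Fb_distZ.
Qed.

(** The representative of a class that vanishes at [x0]; it exists because [M]
is a group, and it makes evaluation at a point Lipschitz on the quotient. *)
Definition base_repr (x0 : X) A (x : X) : M := Fb_repr A x - Fb_repr A x0.

Lemma base_repr_le x0 A B x :
  mdist (base_repr x0 A x) (base_repr x0 B x) <= mdist A B.
Proof. by rewrite mdistB; exact: Fb_gap_le. Qed.

(** Evaluations of [base_repr] being 1-Lipschitz, a Cauchy filter converges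
at each [x]; the rate [l_near] is uniform in [x], which makes the pointwise
limit [l] bounded and makes the filter converge to its class. *)
Lemma Fb_quot_complete : inhabited X -> complete_space M ->
  complete_space (Fb_quot X M).
Proof.
move=> [x0] cM F FF /(@cauchyP K (Fb_quot X M)) cF.
have /choice[l lP] x : exists l : M, base_repr x0 ^~ x @ F --> l.
  apply: cM; apply: (@cauchy_exP K M) => e e0; have [A FA] := cF e e0.
  exists (base_repr x0 A x); apply: (@filterS _ F _ (ball A e)) FA => B.
  by rewrite !ballEmdist /=; exact: le_lt_trans (base_repr_le x0 A B x).
have l_near e A x :
    0 < e -> F (ball A e) -> mdist (l x) (base_repr x0 A x) <= e.
  move=> e0 FA; apply/ler_addgt0Pl => d d0.
  have Fl : F [set B | mdist (l x) (base_repr x0 B x) < d].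
    exact: (metricType_numDomainType.cvgrPdist_lt _ _).1 (lP x) d d0.
  have [B [/= lB]] := filter_ex (filterI Fl FA); rewrite ballEmdist /= => AB.
  apply: le_trans (metric_triangle _ (base_repr x0 B x) _) _.
  apply: lerD (ltW lB) _; rewrite metric_sym.
  exact: le_trans (base_repr_le _ _ _ _) (ltW AB).
have l_bounded : bounded_map l.
  have [A FA] := cF 1 ltr01; have [k kP] := bfunP (Fb_repr A).
  exists (1 + (k + 1)) => x x'.
  apply: le_trans (metric_triangle _ (base_repr x0 A x) _) _.
  rewrite lerD ?l_near //.
  apply: le_trans (metric_triangle _ (base_repr x0 A x') _) _.
  by rewrite lerD ?mdistD2r // metric_sym l_near.
exists (Fb_class (BoundedFun l_bounded)).
apply/(@metricType_numDomainType.fcvgrPdist_lt K (Fb_quot X M)) => e e0.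
have e4 : 0 < e / 4 by rewrite divr_gt0.
have [A FA] := cF _ e4; apply: filterS (FA) => B; rewrite ballEmdist /= => AB.
apply: le_lt_trans (metric_triangle _ A _) _.
apply: (@le_lt_trans _ _ (e / 4 + e / 4 + e / 4)); last by lra.
apply: lerD (ltW AB); rewrite -{1}(Fb_reprK A) mdist_class.
apply: Fb_dist_le => [|x x']; first by rewrite addr_ge0 // ltW.
have -> : diff_dist (l x) (l x') (Fb_repr A x) (Fb_repr A x') =
    diff_dist (l x) (l x') (base_repr x0 A x) (base_repr x0 A x') :> K.
  by rewrite /diff_dist !addrA mdistD2r.
rewrite diff_dist_swap; apply: le_trans (diff_dist_le _ _ _ _) _.
by rewrite lerD ?l_near.
Qed.

End QuotientModule.

(** * The metric on morphisms *)

Section HomDistance.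
Context {K : realType} {C : semi_category K} {M N : object C}.
Implicit Types eta phi psi : morphism M N.

Lemma morD phi : {morph phi : x y / x + y}.
Proof. by case: (morP phi). Qed.

Lemma hom_ratios_bounded eta phi : has_ubound (hom_ratios eta phi).
Proof.
have [[_ [k etak] _] [_ [l phil] _]] := (morP eta, morP phi).
exists (k + l) => _ [m [m' [/eqP mm' ->]]].
rewrite ler_pdivrMr ?mdist_gt0 // mulrDl.
rewrite -[leLHS]/(diff_dist (eta m) (phi m) (eta m') (phi m')) diff_dist_swap.
by apply: le_trans (diff_dist_le _ _ _ _) _; rewrite lerD.
Qed.

Lemma hom_dist_ge0 eta phi : 0 <= hom_dist eta phi.
Proof.
by apply: sup_nonneg => _ [m [m' [_ ->]]]; rewrite divr_ge0 ?mdist_ge0.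
Qed.

(** [eta - phi] is Lipschitz with constant [hom_dist eta phi]. *)
Lemma hom_gap_le eta phi (m m' : M) :
  diff_dist (eta m) (phi m) (eta m') (phi m') <= hom_dist eta phi * mdist m m'.
Proof.
have [<-|mm'] := eqVneq m m'.
  by rewrite diff_distxx mulr_ge0 ?hom_dist_ge0 ?mdist_ge0.
rewrite -ler_pdivrMr ?mdist_gt0 //.
apply: (ub_le_sup (hom_ratios_bounded eta phi)).
by exists m, m'; split=> //; exact/eqP.
Qed.

Lemma hom_dist_le eta phi b : 0 <= b ->
    (forall m m' : M,
       diff_dist (eta m) (phi m) (eta m') (phi m') <= b * mdist m m') ->
  hom_dist eta phi <= b.
Proof.
move=> b0 gap_le; apply: sup_le_nonneg => // _ [m [m' [/eqP mm' ->]]].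
by rewrite ler_pdivrMr ?mdist_gt0 //; exact: gap_le.
Qed.

(** Distance [0] says that [eta - phi] is constant; being additive, it takes the
same value at [m] and [m + m], so that value is [0]. *)
Lemma hom_dist_eq0 eta phi : hom_dist eta phi = 0 -> eta = phi.
Proof.
move=> d0; apply: morphism_ext; apply/funext => m.
have : eta m + phi (m + m) = phi m + eta (m + m).
  apply: mdist_positivity; apply/eqP; rewrite eq_le mdist_ge0 andbT.
  by have := hom_gap_le eta phi m (m + m); rewrite d0 mul0r.
by rewrite !morD Algebra.addrCA => /addrI_metric/addrI_metric.
Qed.

Lemma hom_dist_metric : is_metric (@hom_dist K C M N).
Proof.
have dC eta phi : hom_dist eta phi <= hom_dist phi eta.
  apply: hom_dist_le (hom_dist_ge0 _ _) _ => m m'.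
  by rewrite diff_dist_swap diff_dist_sym diff_dist_swap hom_gap_le.
split=> [|eta phi]; last exact: hom_dist_eq0.
split=> [eta phi|eta|eta phi|eta phi psi]; first exact: hom_dist_ge0.
- apply/eqP; rewrite eq_le hom_dist_ge0 andbT; apply: hom_dist_le => // m m'.
  by rewrite diff_dist_swap diff_distxx mul0r.
- by apply/eqP; rewrite eq_le !dC.
- apply: hom_dist_le => [|m m']; first by rewrite addr_ge0 ?hom_dist_ge0.
  rewrite mulrDl diff_dist_swap.
  apply: le_trans (diff_dist_triangle _ _ (phi m) (phi m') _ _) _.
  by rewrite lerD // diff_dist_swap hom_gap_le.
Qed.

End HomDistance.

(** * The functor attached to an induced structure *)

Section InducedFunctor.
Context {K : realType} {C : semi_category K} {X : Type}.
Context (q : forall M : object C, structure C (Fb_quot X M)).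
Hypothesis q_induced : forall M : object C, is_induced (q M).
Implicit Types M N P : object C.

Local Notation Q M := (Object (q M)).

Lemma Fb_map_lipschitz M N (phi : morphism M N) :
  exists2 k, 0 <= k & forall f g : Fb X M,
    Fb_dist X N (Fb_map phi f) (Fb_map phi g) <= k * Fb_dist X M f g.
Proof. exact: Fb_dist_lipschitz (morD phi). Qed.

Definition quot_map M N (phi : morphism M N) (A : Q M) : Q N :=
  Fb_class (Fb_map phi (Fb_repr A)).

Lemma quot_mapE M N (phi : morphism M N) (f : Fb X M) :
  quot_map phi (Fb_class f) = Fb_class (Fb_map phi f).
Proof.
apply/Fb_class_eqP/eqP; rewrite eq_le Fb_dist_ge0 andbT.
have [k _ kP] := Fb_map_lipschitz phi.
by apply: le_trans (kP _ _) _; rewrite Fb_class_repr mulr0.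
Qed.

Lemma quot_map_morphism M N (phi : morphism M N) : is_morphism (quot_map phi).
Proof.
have [dM addM _ actM] := q_induced M; have [dN addN _ actN] := q_induced N.
split=> [A B||r A].
- have [f ->] := Fb_class_surj A; have [g ->] := Fb_class_surj B.
  rewrite [X in quot_map _ X]addM !quot_mapE [RHS]addN.
  by apply: eq_Fb_class => x /=; exact: morD.
- have [k _ kP] := Fb_map_lipschitz phi; exists k => A B.
  have [f ->] := Fb_class_surj A; have [g ->] := Fb_class_surj B.
  by rewrite !quot_mapE dN dM; exact: kP.
- have [f ->] := Fb_class_surj A; rewrite actM !quot_mapE actN.
  by apply: eq_Fb_class => x /=; case: (morP phi).
Qed.

Definition quot_morphism M N (phi : morphism M N) : morphism (Q M) (Q N) :=
  Morphism (quot_map_morphism phi).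

Lemma quot_morphism_functor :
  is_functor (C := category_of C) (D := category_of C)
    (F0 := fun M : object C => Q M) quot_morphism.
Proof.
split=> [M|M N P psi phi]; apply: morphism_ext; apply/funext => A /=;
  have [f ->] := Fb_class_surj A; rewrite !quot_mapE;
  exact: eq_Fb_class.
Qed.

Lemma mdist_quot_morphism M N (eta phi : morphism M N) (f g : Fb X M) :
  diff_dist (quot_morphism eta (Fb_class f)) (quot_morphism phi (Fb_class f))
    (quot_morphism eta (Fb_class g)) (quot_morphism phi (Fb_class g)) =
  Fb_dist X N (Fb_add (Fb_map eta f) (Fb_map phi g))
    (Fb_add (Fb_map phi f) (Fb_map eta g)).
Proof.
have [dN addN _ _] := q_induced N.
by rewrite /diff_dist /= !quot_mapE !addN dN.
Qed.

Lemma quot_morphism_isometric :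
    inhabited X -> (~ exists x : X, forall y : X, y = x) ->
  is_isometric (C := category_of C) (D := category_of C)
    (@hom_dist K C) (@hom_dist K C) (F0 := fun M : object C => Q M)
    quot_morphism.
Proof.
move=> [x0] X_not_singleton.
split=> [M N|M N|M N eta phi]; try exact: hom_dist_metric.
have [dM _ _ _] := q_induced M.
apply/eqP; rewrite eq_le; apply/andP; split.
  apply: hom_dist_le (hom_dist_ge0 _ _) _ => A B.
  have [f ->] := Fb_class_surj A; have [g ->] := Fb_class_surj B.
  rewrite mdist_quot_morphism dM; apply: Fb_dist_le => [|x x'].
    by rewrite mulr_ge0 ?hom_dist_ge0 ?Fb_dist_ge0.
  rewrite /= diff_dist_shuffle -!morD; apply: le_trans (hom_gap_le _ _ _ _) _.
  by rewrite ler_wpM2l ?hom_dist_ge0 //; exact: Fb_gap_le.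
have [x1 x10] : exists x1, x1 <> x0.
  by apply/existsNP => xx0; apply: X_not_singleton; exists x0.
apply: hom_dist_le (hom_dist_ge0 _ _) _ => m m'.
(* [f] and [g] differ by [m - m'] at [x0] and by [0] at [x1]. *)
pose f0 x := if asbool (x = x0) then m else m'.
have f0_le x x' : mdist (f0 x) (f0 x') <= mdist m m'.
  rewrite /f0; do 2![case: ifP => _]; rewrite ?mdistxx ?mdist_ge0 //.
  by rewrite metric_sym.
pose f : Fb X M := BoundedFun (ex_intro _ _ f0_le).
pose g : Fb X M := Fb_cst m'.
have fg_le : Fb_dist X M f g <= mdist m m'.
  by apply: Fb_dist_le => [|x x']; rewrite ?mdist_ge0 // /diff_dist mdistD2r.
apply: le_trans (ler_wpM2l (hom_dist_ge0 _ _) fg_le).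
rewrite -dM; apply: le_trans (hom_gap_le _ _ _ _).
rewrite mdist_quot_morphism; apply: le_trans (Fb_gap_le _ _ x0 x1).
rewrite /= diff_dist_shuffle /f0 (asboolT (erefl x0)) (asboolF x10).
by rewrite diff_distD2r.
Qed.

End InducedFunctor.

(** * Induced structures in the listed categories *)

Definition Semi_quot (K : realType) (X : Type) (M : object (Semi K)) :
    structure (Semi K) (Fb_quot X M) :=
  MetricSemigroup.class (Fb_quot X M).

Lemma Semi_quot_induced (K : realType) (X : Type) (M : object (Semi K)) :
  is_induced (@Semi_quot K X M).
Proof.
split=> [f g|f g|e e0 A|[]]; [exact: mdist_class | exact: addr_class |].
have [f ->] := Fb_class_surj A.
by rewrite [LHS]addr_class; apply: eq_Fb_class => x /=.
Qed.

Section ModuleQuotients.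
Context {K : realType} (S : subringClosed K) (X : Type).

Definition lmod_of (M : object (RMod S)) : metricLmodType S :=
  MetricLmodule.Pack (object_structure M).

Definition RMod_quot (M : object (RMod S)) : structure (RMod S) (Fb_quot X M) :=
  MetricLmodule.class (Fb_quot X (lmod_of M)).

Lemma RMod_quot_induced (M : object (RMod S)) : is_induced (RMod_quot M).
Proof.
split=> [f g|f g|e e0 A|r f].
- exact: (@mdist_class K X (lmod_of M)).
- exact: (@addr_class K X (lmod_of M)).
- have [f ->] := Fb_class_surj A.
  rewrite [LHS](@addr_class K X (lmod_of M)).
  by apply: eq_Fb_class => x /=; exact: e0.
- exact: (@scaler_class K S X (lmod_of M)).
Qed.

End ModuleQuotients.

(** An induced structure passes to a full subcategory as soon as it preserves
the defining property of its objects. *)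
Section FullSubcategory.
Context {K : realType} {C : semi_category K} {X : Type}.
Context (P : forall T, structure C T -> Prop).
Context (q : forall M : object C, structure C (Fb_quot X M)).
Hypothesis q_induced : forall M : object C, is_induced (q M).
Hypothesis qP : forall M : object C, P (object_structure M) -> P (q M).

Definition ambient_object (M : object (full_sub P)) : object C :=
  Object (sval (object_structure M)).

Definition full_sub_quot (M : object (full_sub P)) :
    structure (full_sub P) (Fb_quot X M) :=
  exist _ (q (ambient_object M))
    (qP (M := ambient_object M) (svalP (object_structure M))).

Lemma full_sub_quot_induced (M : object (full_sub P)) :
  is_induced (full_sub_quot M).
Proof. exact: q_induced (ambient_object M). Qed.

End FullSubcategory.

Lemma induced_quotient_exists (K : realType) (S : subringClosed K)
    (C : semi_category K) (X : Type) : inhabited X ->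
    (C = Semi K \/ C = Mon K \/ C = RMod S \/ C = RNMod S \/
     C = RMod_complete S \/ C = RNMod_complete S) ->
  exists q : forall M : object C, structure C (Fb_quot X M),
    forall M : object C, is_induced (q M).
Proof.
move=> X_nonempty.
pose monoid_structure T (s : structure (Semi K) T) :=
  is_monoid (MetricSemigroup.Pack s).
pose normed_structure T (s : structure (RMod S) T) :=
  is_normed (MetricLmodule.Pack s).
pose complete_structure T (s : structure (RMod S) T) :=
  complete_space (MetricLmodule.Pack s : metricLmodType S).
have semi_induced := @Semi_quot_induced K X.
have mod_induced := @RMod_quot_induced K S X.
have quot_monoid (M : object (Semi K)) :
    monoid_structure _ (object_structure M) ->
    monoid_structure _ (Semi_quot X M).
  case=> e e0; exists (Fb_class (Fb_cst e)).
  by have [_ _ eE _] := semi_induced M; exact: eE.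
have quot_normed (M : object (RMod S)) :
    normed_structure _ (object_structure M) ->
    normed_structure _ (RMod_quot X M).
  exact: (@Fb_quot_normed K S X (lmod_of M)).
have quot_complete (M : object (RMod S)) :
    complete_structure _ (object_structure M) ->
    complete_structure _ (RMod_quot X M).
  exact: (@Fb_quot_complete K S X (lmod_of M)).
have normed_induced := full_sub_quot_induced mod_induced quot_normed.
pose complete_normed_structure T (s : structure (RNMod S) T) :=
  complete_structure T (sval s).
have quot_complete_normed (M : object (RNMod S)) :
    complete_normed_structure _ (object_structure M) ->
    complete_normed_structure _ (full_sub_quot quot_normed M).
  exact: quot_complete (ambient_object M).
case=> [->|[->|[->|[->|[->|->]]]]]; eexists.
- exact: semi_induced.
- exact: (full_sub_quot_induced semi_induced quot_monoid).
- exact: mod_induced.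
- exact: normed_induced.
- exact: (full_sub_quot_induced mod_induced quot_complete).
- exact: (full_sub_quot_induced normed_induced quot_complete_normed).
Qed.

Theorem theorem2p3 (K : realType) (S : subringClosed K) (C : semi_category K)
    (C_listed : C = Semi K \/ C = Mon K \/ C = RMod S \/ C = RNMod S \/
                C = RMod_complete S \/ C = RNMod_complete S)
    (X : Type) (X_nonempty : inhabited X)
    (X_not_singleton : ~ exists x : X, forall y : X, y = x) :
  (forall M : object C,
     (forall f g : Fb X M, has_sup (Fb_gaps f g)) /\
     is_pseudometric (Fb_dist X M)) /\
  (forall M : object C, Equivalence (Fb_sim X M)) /\
  (forall (M N : object C) (eta phi : morphism M N),
     has_ubound (hom_ratios eta phi)) /\
  exists (q : forall M : object C, structure C (Fb_quot X M))
         (F1 : forall M N : object C,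
            morphism M N -> morphism (Object (q M)) (Object (q N))),
    (forall M : object C, is_induced (q M)) /\
    (forall (M N : object C) (phi : morphism M N) (f : Fb X M),
       F1 M N phi (Fb_class f) = Fb_class (Fb_map phi f)) /\
    is_functor (C := category_of C) (D := category_of C)
      (F0 := fun M : object C => Object (q M)) F1 /\
    is_isometric (C := category_of C) (D := category_of C)
      (@hom_dist K C) (@hom_dist K C)
      (F0 := fun M : object C => Object (q M)) F1.
Proof.
have [q q_induced] := induced_quotient_exists X_nonempty C_listed.
have [x0] := X_nonempty.
split=> [M|].
  split=> [f g|]; last exact: Fb_dist_pseudometric.
  split; last exact: Fb_gaps_bounded.
  by exists (diff_dist (f x0) (f x0) (g x0) (g x0)), x0, x0.
split=> [M|]; first exact: Fb_sim_equivalence.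
split=> [M N eta phi|]; first exact: hom_ratios_bounded.
exists q, (quot_morphism q_induced); split=> //; split.
  by move=> M N phi f; exact: quot_mapE.
split; first exact: quot_morphism_functor.
exact: quot_morphism_isometric.
Qed.
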